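(* Let $R$ be a Cohen-Macaulay fiber product ring. Let $M$ and $N$ be nonzero finitely generated $R$-modules. If $N$ is Tor-rigid and $\operatorname{Ext}^1_R(M,N)=0$, then $M$ is free or $\operatorname{pd}_R N\le 1$.
   Context: All local rings are commutative and Noetherian, and all modules are finitely generated; $\operatorname{pd}$ denotes projective dimension. A local ring $(R,\mathfrak m,k)$ is a fiber product ring if $R\cong S\times_k T=\{(s,t)\in S\times T : \pi_S(s)=\pi_T(t)\}$, where $S,T$ are local rings with the same residue field $k$, neither of them equal to $k$, and $\pi_S,\pi_T$ are the reductions modulo the maximal ideals. Equivalently, $\mathfrak m=I\oplus J$ for nonzero ideals $I,J$ of $R$. An $R$-module $N$ is Tor-rigid if for every $R$-module $Z$ and every $n\ge 1$, $\operatorname{Tor}^R_n(N,Z)=0$ implies $\operatorname{Tor}^R_{n+1}(N,Z)=0$. *)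

(* Defs.v *)
From HB Require Import structures.
From mathcomp Require Import all_boot all_order all_algebra.
From mathcomp Require Import boolp.

Set Implicit Arguments.
Unset Strict Implicit.
Unset Printing Implicit Defensive.

Import GRing.Theory.
Local Open Scope ring_scope.
Local Open Scope quotient_scope.


Section Modules.
Variable R : comNzRingType.

Definition in_span (M : lmodType R) (s : seq M) (x : M) : Prop :=
  exists c : 'I_(size s) -> R, x = \sum_(i < size s) c i *: s`_i.

Definition fin_gen (M : lmodType R) : Prop :=
  exists s : seq M, forall x, in_span s x.

Definition nonzero_module (M : lmodType R) : Prop := exists x : M, x != 0.

(* A free module which is finitely generated has a finite basis, so for
   finitely generated modules this is freeness without qualification. *)
Definition free_module (M : lmodType R) : Prop :=
  exists (n : nat) (f : {linear 'rV[R]_n -> M}), bijective f.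

Definition projective (P : lmodType R) : Prop :=
  forall (A B : lmodType R) (g : {linear A -> B}) (f : {linear P -> B}),
    (forall b, exists a, g a = b) ->
    exists h : {linear P -> A}, forall x, g (h x) = f x.

End Modules.


(* Elements of the tensor product are classes of formal sums of pure tensors
   [:: (x1, y1); ...; (xn, yn)], two sums being identified when no bilinear
   map separates them. The universal property is proved below (tens_lift). *)
Section Tensor.
Variables (R : comNzRingType) (M N : lmodType R).

Definition tsum (W : lmodType R) (b : M -> N -> W) (s : seq (M * N)) : W :=
  \sum_(x <- s) b x.1 x.2.

Definition tens_eq (s t : seq (M * N)) : bool :=
  `[< forall (W : lmodType R) (b : {bilinear M -> N -> W}),
        tsum b s = tsum b t >].

Lemma tens_eqP s t : reflect
  (forall (W : lmodType R) (b : {bilinear M -> N -> W}), tsum b s = tsum b t)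
  (tens_eq s t).
Proof. exact: asboolP. Qed.

Lemma tens_eq_equiv : equiv_class_of tens_eq.
Proof.
split=> [s|s t|t s u].
- exact/tens_eqP.
- by apply/tens_eqP/tens_eqP => h W b; rewrite h.
- by move/tens_eqP=> h1 /tens_eqP h2; apply/tens_eqP => W b; rewrite h1 h2.
Qed.

Canonical tens_equivRel := EquivRelPack tens_eq_equiv.

Definition tens := {eq_quot tens_equivRel}.

HB.instance Definition _ := Choice.on tens.

Definition tens_class (s : seq (M * N)) : tens := \pi_{eq_quot tens_equivRel} s.
Definition tens_repr (x : tens) : seq (M * N) := repr x.

Lemma tens_classP s t : tens_class s = tens_class t <->
  forall (W : lmodType R) (b : {bilinear M -> N -> W}), tsum b s = tsum b t.
Proof.
by split=> [/eqmodP/tens_eqP//|h]; apply/eqmodP/tens_eqP.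
Qed.

Lemma tens_reprK x : tens_class (tens_repr x) = x.
Proof. exact: reprK. Qed.

Lemma tsum_repr (W : lmodType R) (b : {bilinear M -> N -> W}) s :
  tsum b (tens_repr (tens_class s)) = tsum b s.
Proof. by move: W b; apply/tens_classP; rewrite tens_reprK. Qed.

Definition tscale_seq (a : R) (s : seq (M * N)) : seq (M * N) :=
  [seq (a *: x.1, x.2) | x <- s].

Lemma tsum_cat (W : lmodType R) (b : {bilinear M -> N -> W}) s t :
  tsum b (s ++ t) = tsum b s + tsum b t.
Proof. exact: big_cat. Qed.

Lemma tsum_scale (W : lmodType R) (b : {bilinear M -> N -> W}) a s :
  tsum b (tscale_seq a s) = a *: tsum b s.
Proof.
rewrite /tsum big_map scaler_sumr; apply: eq_bigr => x _ /=.
by rewrite linearZl_LR.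
Qed.

Lemma tsum_nil (W : lmodType R) (b : {bilinear M -> N -> W}) :
  tsum b [::] = 0.
Proof. exact: big_nil. Qed.

Definition tens_zero : tens := tens_class [::].
Definition tens_add (x y : tens) : tens :=
  tens_class (tens_repr x ++ tens_repr y).
Definition tens_scale (a : R) (x : tens) : tens :=
  tens_class (tscale_seq a (tens_repr x)).
Definition tens_opp (x : tens) : tens := tens_scale (-1) x.

Definition tens_simp :=
  (@tsum_repr, @tsum_cat, @tsum_scale, @tsum_nil).

Lemma tens_addA : associative tens_add.
Proof.
by move=> x y z; apply/tens_classP => W b; rewrite !tens_simp addrA.
Qed.

Lemma tens_addC : commutative tens_add.
Proof. by move=> x y; apply/tens_classP => W b; rewrite !tens_simp addrC. Qed.

Lemma tens_add0 : left_id tens_zero tens_add.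
Proof.
move=> x; rewrite -[RHS]tens_reprK.
by apply/tens_classP => W b; rewrite !tens_simp add0r.
Qed.

Lemma tens_addN : left_inverse tens_zero tens_opp tens_add.
Proof.
move=> x; apply/tens_classP => W b.
by rewrite !tens_simp scaleN1r addNr.
Qed.

HB.instance Definition _ :=
  GRing.isZmodule.Build tens tens_addA tens_addC tens_add0 tens_addN.

Lemma tens_scaleA a b x : tens_scale a (tens_scale b x) = tens_scale (a * b) x.
Proof. by apply/tens_classP => W f; rewrite !tens_simp scalerA. Qed.

Lemma tens_scale1 : left_id 1 tens_scale.
Proof.
move=> x; rewrite -[RHS]tens_reprK.
by apply/tens_classP => W b; rewrite !tens_simp scale1r.
Qed.

Lemma tens_scaleDr : right_distributive tens_scale +%R.
Proof.
by move=> a x y; apply/tens_classP => W b; rewrite !tens_simp scalerDr.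
Qed.

Lemma tens_scaleDl x : {morph tens_scale^~ x : a b / a + b}.
Proof.
by move=> a b; apply/tens_classP => W f; rewrite !tens_simp scalerDl.
Qed.

HB.instance Definition _ := GRing.Zmodule_isLmodule.Build R tens
  tens_scaleA tens_scale1 tens_scaleDr tens_scaleDl.

Definition pure (x : M) (y : N) : tens := tens_class [:: (x, y)].

Lemma tsum1 (W : lmodType R) (b : {bilinear M -> N -> W}) x y :
  tsum b [:: (x, y)] = b x y.
Proof. exact: big_seq1. Qed.

Lemma pure_bilinear : bilinear_for
  (GRing.Scale.Law.clone _ _ *:%R _) (GRing.Scale.Law.clone _ _ *:%R _) pure.
Proof.
split=> z a x y; apply/tens_classP => W b;
  by rewrite !(tens_simp, tsum1) ?linearPl ?linearPr.
Qed.

HB.instance Definition _ :=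
  bilinear_isBilinear.Build R M N tens *:%R *:%R pure pure_bilinear.

Lemma tens_class_sum s : tens_class s = \sum_(x <- s) pure x.1 x.2.
Proof.
elim: s => [|[x y] s IHs]; first by rewrite big_nil.
rewrite big_cons -IHs; apply/tens_classP => W b.
by rewrite !(tens_simp, tsum1) /tsum big_cons.
Qed.

Section Lift.
Variables (W : lmodType R) (b : {bilinear M -> N -> W}).

Definition tens_lift (x : tens) : W := tsum b (tens_repr x).

Lemma tens_lift_linear : linear tens_lift.
Proof. by move=> a x y; rewrite /tens_lift !tens_simp. Qed.

HB.instance Definition _ :=
  GRing.isLinear.Build R tens W *:%R tens_lift tens_lift_linear.

Lemma tens_lift_pure x y : tens_lift (pure x y) = b x y.
Proof. by rewrite /tens_lift tsum_repr tsum1. Qed.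

Lemma tens_lift_unique (g : {linear tens -> W}) :
  (forall x y, g (pure x y) = b x y) -> g =1 tens_lift.
Proof.
move=> gE x; rewrite -[x]tens_reprK tens_class_sum !linear_sum.
by apply: eq_bigr => y _; rewrite gE -tens_lift_pure.
Qed.

End Lift.
End Tensor.

Section TensorMap.
Variables (R : comNzRingType) (M M' N : lmodType R) (f : {linear M -> M'}).

Definition pure_left (x : M) (y : N) : tens M' N := pure (f x) y.

Lemma pure_left_bilinear : bilinear_for
  (GRing.Scale.Law.clone _ _ *:%R _) (GRing.Scale.Law.clone _ _ *:%R _)
  pure_left.
Proof.
by split=> z a x y; rewrite /pure_left ?linearP ?linearPl ?linearPr.
Qed.

HB.instance Definition _ :=
  bilinear_isBilinear.Build R M N (tens M' N) *:%R *:%R pure_left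
    pure_left_bilinear.

(* f tensored with the identity of N *)
Definition tens_map : {linear tens M N -> tens M' N} := tens_lift pure_left.

Lemma tens_map_pure x y : tens_map (pure x y) = pure (f x) y.
Proof. exact: tens_lift_pure. Qed.

End TensorMap.


Section Homological.
Variable R : comNzRingType.

Record proj_resolution (M : lmodType R) := ProjResolution {
  res_mod :> nat -> lmodType R;
  res_diff : forall n, {linear res_mod n.+1 -> res_mod n};
  res_aug : {linear res_mod 0 -> M};
  res_projective : forall n, projective (res_mod n);
  res_aug_surj : forall y, exists x, res_aug x = y;
  res_exact0 : forall x, res_aug x = 0 <-> exists y, res_diff 0 y = x;
  res_exact : forall n x, res_diff n x = 0 <-> exists y, res_diff n.+1 y = x
}.

Definition pd_le (M : lmodType R) (d : nat) : Prop :=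
  exists P : proj_resolution M, forall n, (d < n)%N -> forall x : P n, x = 0.

Section Tor.
Variables (N Z : lmodType R) (P : proj_resolution N).

Definition tor_cycle (n : nat) : tens (P n) Z -> Prop :=
  match n with
  | 0 => fun _ => True
  | m.+1 => fun x => tens_map Z (res_diff P m) x = 0
  end.

Definition tor_boundary (n : nat) (x : tens (P n) Z) : Prop :=
  exists y, tens_map Z (res_diff P n) y = x.

End Tor.

(* H_n of (P tensor Z) vanishes; the choice of the projective resolution P of N is
   immaterial, and one always exists. *)
Definition Tor_eq0 (n : nat) (N Z : lmodType R) : Prop :=
  forall (P : proj_resolution N) (x : tens (P n) Z),
    tor_cycle x -> tor_boundary x.

Definition Tor_rigid (N : lmodType R) : Prop :=
  forall (Z : lmodType R), fin_gen Z ->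
  forall n, (1 <= n)%N -> Tor_eq0 n N Z -> Tor_eq0 n.+1 N Z.

Section Ext.
Variables (M N : lmodType R) (P : proj_resolution M).

Definition ext_cocycle (n : nat) (f : {linear P n -> N}) : Prop :=
  forall x, f (res_diff P n x) = 0.

Definition ext_coboundary (n : nat) : {linear P n -> N} -> Prop :=
  match n with
  | 0 => fun f => forall x, f x = 0
  | m.+1 => fun f => exists g : {linear P m -> N},
              forall x, f x = g (res_diff P m x)
  end.

End Ext.

(* H^n(Hom(P, N)) = 0, with the same remark on P. *)
Definition Ext_eq0 (n : nat) (M N : lmodType R) : Prop :=
  forall (P : proj_resolution M) (f : {linear P n -> N}),
    ext_cocycle f -> ext_coboundary f.

End Homological.


(* Ideals are boolean predicates; since classical choice is assumed
   (through boolp) every subset of R is one. idealr_closed includes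
   properness. *)
Section LocalRings.
Variable R : comNzRingType.

Definition noetherian : Prop :=
  forall I : {pred R}, idealr_closed I ->
    exists s : seq R, forall x, x \in I <-> in_span (s : seq R^o) x.

Definition maximal_ideal (m : {pred R}) : Prop :=
  idealr_closed m /\
  forall I : {pred R}, idealr_closed I -> {subset m <= I} -> I =i m.

Definition local_ring : Prop :=
  exists2 m : {pred R}, maximal_ideal m &
    forall m' : {pred R}, maximal_ideal m' -> m' =i m.

Definition noetherian_local : Prop := noetherian /\ local_ring.

Definition prime_ideal (p : {pred R}) : Prop :=
  idealr_closed p /\ prime_idealr_closed p.

Definition prime_chain (c : nat -> {pred R}) (n : nat) : Prop :=
  (forall i, (i <= n)%N -> prime_ideal (c i)) /\
  (forall i, (i < n)%N ->
     {subset c i <= c i.+1} /\ ~ {subset c i.+1 <= c i}).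

Definition krull_dim_is (d : nat) : Prop :=
  (exists c, prime_chain c d) /\ (forall c n, prime_chain c n -> (n <= d)%N).

Definition regular_seq (xs : seq R) : Prop :=
  ~ in_span (xs : seq R^o) 1 /\
  forall i, (i < size xs)%N -> forall r : R,
    in_span (take i xs : seq R^o) (xs`_i * r) ->
    in_span (take i xs : seq R^o) r.

Definition depth_is (d : nat) : Prop :=
  forall m : {pred R}, maximal_ideal m ->
    (exists xs : seq R, [/\ {subset xs <= m}, regular_seq xs & size xs = d]) /\
    (forall xs : seq R, {subset xs <= m} -> regular_seq xs -> (size xs <= d)%N).

Definition cohen_macaulay : Prop :=
  exists d, depth_is d /\ krull_dim_is d.

End LocalRings.

(* R is isomorphic to S x_k T. As S and T are local and piS, piT are onto the
   field k, these are the reductions modulo the maximal ideals; that they are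
   not injective says that S and T differ from k. *)
Definition fiber_product_ring (R : comNzRingType) : Prop :=
  noetherian_local R /\
  exists (S T : comNzRingType) (k : fieldType)
         (piS : {rmorphism S -> k}) (piT : {rmorphism T -> k}),
    [/\ noetherian_local S /\ noetherian_local T,
        (forall a, exists s, piS s = a) /\ (forall a, exists t, piT t = a),
        ~ injective piS /\ ~ injective piT
      & exists f : {rmorphism R -> (S * T)%type},
          injective f /\
          forall u : S * T, (exists r, f r = u) <-> piS u.1 = piT u.2].

(* Main.v *)
Require Import Defs.
From HB Require Import structures.
From mathcomp Require Import all_boot all_order all_algebra.
From mathcomp Require Import boolp.
From mathcomp Require classical_sets.
Local Open Scope ring_scope.

(** Let R be the fiber product of S and T over the residue field k.  Its
    maximal ideal is the direct sum of the nonzero ideals I (the kernel of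
    R -> T) and J (the kernel of R -> S), and I J = 0.

    Take a minimal free resolution of M with matrices A 0, A 1, ..., let E 0 be
    the transpose of A 1 and let Z be its cokernel: Z is the Auslander transpose
    of the first syzygy of M.  A diagram chase shows that Ext^1(M, N) = 0 forces
    Tor_1(N, Z) = 0 ([Tor1_transpose]), so all Tor_n(N, Z) with n >= 1 vanish by
    rigidity.  As N is nonzero, Nakayama's lemma also extracts from
    Ext^1(M, N) = 0 that the kernel of E 0 has all its coordinates in the
    maximal ideal ([transpose_minimal]).  Hence E 0 starts a minimal free
    resolution E of Z.

    Let D be a minimal free resolution of N.  Let L be the kernel of D 0 and K
    that of E 0, which are generated by the rows of D 1 and of E 1.  The heart
    of the proof ([fiber_product_vanishing]) is that Tor_4(N, Z) = 0 and
    Tor_5(N, Z) = 0 imply L = 0 or K = 0.  The components along I and J of an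
    element of L are again in L, and by Nakayama's lemma either L has a minimal
    generator with coordinates in J, or all of L has coordinates in I
    ([type_dichotomy]); the same holds for K and for the later syzygies.  If a
    is a minimal generator of L with coordinates in I and b one of K with
    coordinates in J, then the image of a (x) b in the tensor product of the
    free modules is 0 since I J = 0, while a (x) b is nonzero in L (x) K
    modulo the maximal ideal; so the Tor_2 of the first syzygies of N and Z,
    which is Tor_4(N, Z), is nonzero ([mixed_types]).  So if L has a minimal
    generator with coordinates in I, then all of K has coordinates in I.  If K
    is also nonzero, then, as J kills K, the next syzygy contains nonzero
    vectors with coordinates in J; the same argument one step further, now with
    Tor_5(N, Z) = 0, gives a contradiction ([pure_type_vanishing]).  The roles
    of I and J can be exchanged; and if L has no minimal generator with
    coordinates in I and none with coordinates in J, then L = 0 by the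
    dichotomy.

    If L = 0, then N has projective dimension at most 1.  If K = 0, then E 0 is
    injective and kills the transpose of A 0, so A 0 = 0 and M is free. *)

Set Implicit Arguments.
Unset Strict Implicit.
Unset Printing Implicit Defensive.
Import GRing.Theory.
Local Open Scope quotient_scope.

(** * Quotient modules *)

Section QuotientModule.
Variables (R : comNzRingType) (V : lmodType R) (S : V -> Prop).
Hypotheses (S0 : S 0) (Slin : forall a u v, S u -> S v -> S (a *: u + v)).

Let SN v : S v -> S (- v).
Proof. by move=> Sv; rewrite -scaleN1r -[_ *: _]addr0; apply: Slin. Qed.

Let SD u v : S u -> S v -> S (u + v).
Proof. by move=> Su Sv; rewrite -[u]scale1r; apply: Slin. Qed.

(** Congruence modulo the submodule [S]. *)
Definition quot_mod_eq (u v : V) : bool := `[< S (u - v) >].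

Lemma quot_mod_equiv : equiv_class_of quot_mod_eq.
Proof.
split=> [u|u v|v u w].
- by apply/asboolP; rewrite subrr.
- by apply/asboolP/asboolP => /SN; rewrite opprB.
- move=> /asboolP uv /asboolP vw; apply/asboolP.
  by rewrite -[u](subrK v) -addrA; apply: SD.
Qed.

Canonical quot_mod_equivRel := EquivRelPack quot_mod_equiv.
(** The quotient of [V] by the submodule [S]. *)
Definition quot_mod := {eq_quot quot_mod_equivRel}.
HB.instance Definition _ := Choice.on quot_mod.

Definition quot_class (v : V) : quot_mod := \pi_{eq_quot quot_mod_equivRel} v.
Definition quot_repr (x : quot_mod) : V := repr x.

Lemma quot_classP u v : quot_class u = quot_class v <-> S (u - v).
Proof. by split=> [/eqmodP/asboolP//|h]; apply/eqmodP/asboolP. Qed.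

Lemma quot_reprK x : quot_class (quot_repr x) = x.
Proof. exact: reprK. Qed.

Lemma quot_reprP v : S (quot_repr (quot_class v) - v).
Proof. by apply/quot_classP; rewrite quot_reprK. Qed.

Definition quot_mod_add x y := quot_class (quot_repr x + quot_repr y).
Definition quot_mod_opp x := quot_class (- quot_repr x).
Definition quot_mod_scale a x := quot_class (a *: quot_repr x).

Lemma quot_mod_addE u v :
  quot_mod_add (quot_class u) (quot_class v) = quot_class (u + v).
Proof.
by apply/quot_classP; rewrite opprD addrACA; apply: SD; apply: quot_reprP.
Qed.

Lemma quot_mod_oppE u : quot_mod_opp (quot_class u) = quot_class (- u).
Proof. by apply/quot_classP; rewrite -opprD; apply/SN/quot_reprP. Qed.

Lemma quot_mod_scaleE a u :
  quot_mod_scale a (quot_class u) = quot_class (a *: u).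
Proof.
apply/quot_classP; rewrite -scalerBr -[_ *: _]addr0; apply: Slin => //.
exact: quot_reprP.
Qed.

Lemma quot_mod_ind (P : quot_mod -> Prop) :
  (forall v, P (quot_class v)) -> forall x, P x.
Proof. by move=> h x; rewrite -[x]quot_reprK. Qed.

Lemma quot_mod_addA : associative quot_mod_add.
Proof. by do 3!elim/quot_mod_ind=> ?; rewrite !quot_mod_addE addrA. Qed.
Lemma quot_mod_addC : commutative quot_mod_add.
Proof. by do 2!elim/quot_mod_ind=> ?; rewrite !quot_mod_addE addrC. Qed.
Lemma quot_mod_add0 : left_id (quot_class 0) quot_mod_add.
Proof. by elim/quot_mod_ind=> ?; rewrite !quot_mod_addE add0r. Qed.
Lemma quot_mod_addN : left_inverse (quot_class 0) quot_mod_opp quot_mod_add.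
Proof. by elim/quot_mod_ind=> ?; rewrite quot_mod_oppE quot_mod_addE addNr. Qed.

HB.instance Definition _ :=
  GRing.isZmodule.Build quot_mod
    quot_mod_addA quot_mod_addC quot_mod_add0 quot_mod_addN.

Lemma quot_mod_scaleA a b x :
  quot_mod_scale a (quot_mod_scale b x) = quot_mod_scale (a * b) x.
Proof. by elim/quot_mod_ind: x => ?; rewrite !quot_mod_scaleE scalerA. Qed.
Lemma quot_mod_scale1 : left_id 1 quot_mod_scale.
Proof. by elim/quot_mod_ind=> ?; rewrite quot_mod_scaleE scale1r. Qed.
Lemma quot_mod_scaleDr : right_distributive quot_mod_scale +%R.
Proof.
move=> a; do 2!elim/quot_mod_ind=> ?.
rewrite (quot_mod_addE _ _ : quot_class _ + quot_class _ = _) !quot_mod_scaleE.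
by rewrite scalerDr -quot_mod_addE.
Qed.
Lemma quot_mod_scaleDl x : {morph quot_mod_scale^~ x : a b / a + b}.
Proof.
elim/quot_mod_ind: x => ? a b.
by rewrite !quot_mod_scaleE scalerDl -quot_mod_addE.
Qed.

HB.instance Definition _ := GRing.Zmodule_isLmodule.Build R quot_mod
  quot_mod_scaleA quot_mod_scale1 quot_mod_scaleDr quot_mod_scaleDl.

Lemma quot_class_linear : linear quot_class.
Proof.
by move=> a u v; rewrite -quot_mod_addE -quot_mod_scaleE.
Qed.

HB.instance Definition _ :=
  GRing.isLinear.Build R V quot_mod *:%R quot_class quot_class_linear.

Lemma quotient_module_exists : exists (W : lmodType R) (p : {linear V -> W}),
  (forall w, exists v, p v = w) /\ (forall v, p v = 0 <-> S v).
Proof.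
exists quot_mod, quot_class; split; first by elim/quot_mod_ind=> v; exists v.
move=> v; split; last by move=> Sv; apply/(quot_classP v 0); rewrite subr0.
by move/(quot_classP v 0); rewrite subr0.
Qed.

End QuotientModule.

(** * Tensor products with the cokernel of a matrix *)

Section TensorCokernel.
Variables (R : comNzRingType) (g h : nat) (E : 'M[R]_(g, h)).
Variables (Z : lmodType R) (p : {linear 'rV[R]_h -> Z}).
Hypotheses (p_surj : forall z, exists v, p v = z)
  (p_ker : forall v, p v = 0 <-> exists u, v = u *m E).

(** The module [Z] being presented by [E], this is the composite
    [V^h -> V (x) R^h -> V (x) Z]. *)
Definition tens_of_vec (V : lmodType R) (x : 'I_h -> V) : tens V Z :=
  \sum_j pure (x j) (p (delta_mx 0 j)).

(** The map [V^g -> V^h] obtained by tensoring [E], which acts on row vectors,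
    with [V]. *)
Definition vec_act (V : lmodType R) (y : 'I_g -> V) (j : 'I_h) : V :=
  \sum_i E i j *: y i.

Lemma tens_of_vec_surj (V : lmodType R) (t : tens V Z) :
  exists x, t = tens_of_vec x.
Proof.
rewrite -[t]tens_reprK tens_class_sum; elim: (tens_repr t) => [|[v z] s [x sE]].
  exists (fun=> 0); rewrite big_nil /tens_of_vec big1 // => j _.
  by rewrite linear0l.
have [w <-] := p_surj z; exists (fun j => w 0 j *: v + x j).
rewrite big_cons sE /tens_of_vec /= [in LHS](row_sum_delta w) linear_sum.
rewrite linear_sumr -big_split; apply: eq_bigr => j _ /=.
by rewrite linearPl linearZ linearZr_LR.
Qed.

(** Right exactness of the tensor product, for this presentation of [Z].  The
    direct implication pairs [x] with a bilinear map from [V] and [Z] to the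
    cokernel of [V^g -> V^h]. *)
Lemma tens_of_vec_eq0 (V : lmodType R) (x : 'I_h -> V) :
  tens_of_vec x = 0 <-> exists y, x =1 vec_act y.
Proof.
split=> [x0|[y xE]]; last first.
  rewrite /tens_of_vec.
  rewrite (eq_bigr (fun j => \sum_i pure (y i) (E i j *: p (delta_mx 0 j)))).
    rewrite exchange_big big1 // => i _; rewrite -linear_sumr /=.
    suff -> : \sum_j E i j *: p (delta_mx 0 j) = 0 by rewrite linear0r.
    under eq_bigr do rewrite -linearZ /=.
    rewrite -linear_sum; apply/p_ker; exists (delta_mx 0 i).
    by rewrite -rowE [RHS]row_sum_delta; apply: eq_bigr => j _; rewrite mxE.
  move=> j _; rewrite xE linear_sumlz; apply: eq_bigr => i _.
  by rewrite linearZl_LR linearZr_LR.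
pose S (f : {ffun 'I_h -> V}) := exists y, f =1 vec_act y.
have S0 : S 0.
  by exists (fun=> 0) => j; rewrite ffunE /vec_act big1 // => i _;
     rewrite scaler0.
have Slin a u v : S u -> S v -> S (a *: u + v).
  move=> [y yE] [y' y'E]; exists (fun i => a *: y i + y' i) => j.
  rewrite !ffunE yE y'E /vec_act scaler_sumr -big_split.
  apply: eq_bigr => i _ /=.
  by rewrite scalerDr !scalerA [a * _]mulrC.
have [W [c [_ cE]]] := quotient_module_exists S0 Slin.
have [q qE] := choice p_surj.
(* The value of b does not depend on the lift of z along p (see bwd), which
   makes b bilinear. *)
pose b (v : V) (z : Z) : W := c [ffun j => q z 0 j *: v].
have bwd v z w : p w = z -> b v z = c [ffun j => w 0 j *: v].
  move=> wz; apply/eqP; rewrite -subr_eq0 -linearB; apply/eqP/cE.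
  have /p_ker[u uE] : p (q z - w) = 0 by rewrite linearB qE wz subrr.
  exists (fun i => u 0 i *: v) => j; rewrite !ffunE -scalerBl.
  have -> : q z 0 j - w 0 j = (q z - w) 0 j by rewrite !mxE.
  rewrite uE mxE scaler_suml; apply: eq_bigr => i _.
  by rewrite scalerA mulrC.
have bbil : bilinear_for
  (GRing.Scale.Law.clone _ _ *:%R _) (GRing.Scale.Law.clone _ _ *:%R _) b.
  split=> [z a u v|v a z z'].
    rewrite /b -linearP; congr (c _); apply/ffunP => j; rewrite !ffunE.
    by rewrite scalerDr !scalerA mulrC.
  rewrite (bwd v _ (a *: q z + q z')); last by rewrite linearP !qE.
  rewrite /b -linearP; congr (c _); apply/ffunP => j; rewrite !ffunE !mxE.
  by rewrite scalerDl scalerA.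
pose bi := bilinear_isBilinear.Build R V Z W *:%R *:%R b bbil.
pose B : {bilinear V -> Z -> W} := HB.pack b bi.
have : tens_lift B (tens_of_vec x) = 0 by rewrite x0 linear0.
rewrite linear_sum (eq_bigr _ (fun j _ => tens_lift_pure B _ _)).
have -> : \sum_j B (x j) (p (delta_mx 0 j)) = c [ffun j => x j].
  rewrite (eq_bigr (fun i => c [ffun j => (j == i)%:R *: x i])); last first.
    move=> i _; rewrite [LHS](bwd _ _ (delta_mx 0 i)) //; congr (c _).
    by apply/ffunP => j; rewrite !ffunE mxE eqxx.
  rewrite -linear_sum; congr (c _); apply/ffunP => j.
  rewrite sum_ffunE ffunE (bigD1 j) //= big1 ?addr0.
    by rewrite ffunE eqxx scale1r.
  by move=> i /negPf ij; rewrite ffunE eq_sym ij scale0r.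
by move/cE=> [y yE]; exists y => j; rewrite -yE ffunE.
Qed.

End TensorCokernel.

(** * Free modules of row vectors *)

Section LinearCombinations.
Variables (R : comNzRingType) (V : lmodType R).

(** The linear map out of a free module given by the images [x] of the standard
    basis. *)
Definition lincomb m (x : 'I_m -> V) (u : 'rV[R]_m) : V := \sum_i u 0 i *: x i.

Lemma lincomb_linear m (x : 'I_m -> V) : linear (lincomb x).
Proof.
move=> a u v; rewrite /lincomb scaler_sumr -big_split; apply: eq_bigr => i _.
by rewrite !mxE scalerDl scalerA.
Qed.

HB.instance Definition _ m (x : 'I_m -> V) :=
  GRing.isLinear.Build R 'rV[R]_m V *:%R (lincomb x) (lincomb_linear x).

Lemma lincomb_delta m (x : 'I_m -> V) i : lincomb x (delta_mx 0 i) = x i.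
Proof.
rewrite /lincomb (bigD1 i) //= big1 => [|j /negPf ji]; rewrite mxE ?eqxx ?ji.
  by rewrite addr0 scale1r.
by rewrite scale0r.
Qed.

Lemma linear_lincomb m (f : {linear 'rV[R]_m -> V}) :
  f =1 lincomb (fun i => f (delta_mx 0 i)).
Proof.
move=> u; rewrite [u in LHS]row_sum_delta linear_sum.
by apply: eq_bigr => i _; rewrite linearZ.
Qed.

End LinearCombinations.

Lemma lincomb_row (R : comNzRingType) m n (E : 'M[R]_(m, n)) u :
  lincomb (fun i => row i E) u = u *m E.
Proof. by rewrite mulmx_sum_row. Qed.

Lemma row_projective (R : comNzRingType) n : projective 'rV[R]_n.
Proof.
move=> A B g f g_surj.
have [a aE] := choice (fun i => g_surj (f (delta_mx 0 i))).
exists (lincomb a) => u; rewrite [RHS]linear_lincomb linear_sum.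
by apply: eq_bigr => i _; rewrite linearZ /= aE.
Qed.

(** * Minimal generators and minimal free resolutions *)

Section Noetherian.
Variables (R : comNzRingType) (noethR : noetherian R).

(** Unlike in the definition of a Noetherian ring, the ideal need not be
    proper. *)
Lemma noetherian_ideal (P : R -> Prop) :
  P 0 -> (forall a u v, P u -> P v -> P (a * u + v)) ->
  exists m (s : 'I_m -> R), forall x,
    P x <-> exists u : 'rV_m, x = \sum_i u 0 i * s i.
Proof.
move=> P0 Plin; have [P1|nP1] := pselect (P 1).
  exists 1%N, (fun=> 1) => x; split=> [_|[u ->]].
    by exists (const_mx x); rewrite big_ord1 mxE mulr1.
  by rewrite big_ord1 -[_ * _]addr0; apply: Plin.
pose I : {pred R} := fun x => `[< P x >].
have idI : idealr_closed I.
  split; first exact/asboolP.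
    by apply/asboolP.
  by move=> a u v /asboolP Pu /asboolP Pv; apply/asboolP/Plin.
have [s sP] := noethR idI.
exists (size s), (fun i => s`_i) => x.
have -> : P x <-> x \in I by split=> /asboolP.
rewrite sP; split=> -[c ->]; last by exists (c 0).
by exists (\row_i c i); apply: eq_bigr => i _; rewrite mxE.
Qed.

(** Submodules of [R^n] are finitely generated: induction on [n], by the ideal
    of first coordinates and the vectors whose first coordinate is zero. *)
Lemma noetherian_row n (P : 'rV[R]_n -> Prop) :
  P 0 -> (forall a u v, P u -> P v -> P (a *: u + v)) ->
  exists m (E : 'M[R]_(m, n)), forall v, P v <-> exists u, v = u *m E.
Proof.
elim: n P => [|n IHn] P P0 Plin.
  exists 0%N, 0 => v; rewrite [v]thinmx0; split=> // _.
  by exists 0; rewrite mul0mx.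
rewrite -[n.+1]/(1 + n)%N in P P0 Plin *.
have PZ a u : P u -> P (a *: u).
  by move=> Pu; rewrite -[_ *: _]addr0; apply: Plin.
have PD u v : P u -> P v -> P (u + v).
  by move=> Pu Pv; rewrite -[u]scale1r; apply: Plin.
have PM m (E : 'M_(m, 1 + n)) u : (forall i, P (row i E)) -> P (u *m E).
  move=> PE; rewrite mulmx_sum_row; elim/big_ind: _ => // i _.
  exact: PZ.
pose c0 : 'I_(1 + n) := lshift n 0.
pose I x := exists2 v, P v & v 0 c0 = x.
have [||m [s sI]] := @noetherian_ideal I.
- by exists 0; rewrite ?mxE.
- move=> a x y [v Pv <-] [w Pw <-]; exists (a *: v + w); first exact: Plin.
  by rewrite !mxE.
have sP i : exists v, P v /\ v 0 c0 = s i.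
  have [|v] := (sI (s i)).2; last by exists v.
  exists (delta_mx 0 i); rewrite (bigD1 i) //= big1 => [|j /negPf ji].
    by rewrite mxE !eqxx mul1r addr0.
  by rewrite mxE ji mul0r.
pose A := \matrix_i sval (cid (sP i)).
have PA i : P (row i A) by rewrite rowK; case: cid => v [].
have [||m' [B BP]] := IHn (fun w => P (row_mx (0 : 'M_(1, 1)) w)).
- by rewrite row_mx0.
- move=> a u v Pu Pv; rewrite -[0](addr0 0) -{1}(scaler0 _ a).
  by rewrite -add_row_mx -scale_row_mx; apply: Plin.
pose B' : 'M_(m', 1 + n) := row_mx 0 B.
exists (m + m')%N, (col_mx A B') => v; split=> [Pv|[u ->]]; last first.
  rewrite -[u]hsubmxK mul_row_col; apply: PD; first exact: PM.
  by rewrite /B' mul_mx_row mulmx0; apply/BP; eexists.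
have [u uE] : exists u : 'rV_m, v 0 c0 = \sum_i u 0 i * s i.
  by apply/sI; exists v.
pose w : 'rV_(1 + n) := v - u *m A.
have Pw : P w by rewrite /w -scaleN1r addrC; apply: Plin => //; apply: PM.
have w0 : lsubmx w = 0.
  apply/matrixP=> i j; rewrite !ord1 !mxE.
  rewrite -/c0 uE; apply/eqP; rewrite subr_eq0; apply/eqP/eq_bigr => l _.
  by rewrite mxE; case: cid => /= ? [_ ->].
move: Pw; rewrite -[w]hsubmxK w0 => /BP[u' u'E].
exists (row_mx u u'); rewrite mul_row_col /B' mul_mx_row mulmx0.
by rewrite -u'E -w0 hsubmxK /w addrC subrK.
Qed.

End Noetherian.

Section MinimalGenerators.
Variables (R : comNzRingType) (k : fieldType) (rho : {rmorphism R -> k}).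
Hypothesis rho_unit : forall x, rho x != 0 -> exists y, y * x = 1.

(** With [rho] the residue map, all relations between the [x i] have
    coefficients in the maximal ideal: [x] is a minimal system of generators of
    its span. *)
Definition minimal_family (V : lmodType R) m (x : 'I_m -> V) :=
  forall u, lincomb x u = 0 -> map_mx rho u = 0.

Lemma minimal_generators (V : lmodType R) (P : V -> Prop) m (x : 'I_m -> V) :
  (forall v, P v <-> exists u, v = lincomb x u) ->
  exists m' (x' : 'I_m' -> V),
    (forall v, P v <-> exists u, v = lincomb x' u) /\ minimal_family x'.
Proof.
elim: m x => [|m IHm] x gen.
  by exists 0%N, x; split=> // u _; apply/matrixP => i [].
have [|nmin] := pselect (minimal_family x); first by exists m.+1, x.
have [u [u0 [i ui]]] : exists u, lincomb x u = 0 /\ exists i, rho (u 0 i) != 0.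
  apply: contrapT => nex; apply: nmin => u u0; apply/matrixP => l i.
  rewrite ord1 !mxE; apply/eqP/negPn/negP => ui; apply: nex.
  by exists u; split=> //; exists i.
have [y yu] := rho_unit ui.
apply: (IHm (x \o lift i)) => v; rewrite gen; split=> -[w ->].
  (* Subtracting a multiple of the relation u makes coordinate i vanish. *)
  pose z := w - (w 0 i * y) *: u.
  exists (\row_j z 0 (lift i j)).
  have -> : lincomb x w = lincomb x z.
    by rewrite linearB linearZ /= u0 scaler0 subr0.
  rewrite {1}/lincomb (bigD1_ord i) //= !mxE -mulrA yu mulr1 subrr scale0r.
  rewrite add0r.
  by apply: eq_bigr => j _; rewrite !mxE.
exists (\row_j if unlift i j is Some j' then w 0 j' else 0).
rewrite /lincomb [RHS](bigD1_ord i) //= !mxE unlift_none scale0r add0r.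
by apply: eq_bigr => j _; rewrite !mxE liftK.
Qed.

Hypothesis noethR : noetherian R.

Lemma minimal_rows n (P : 'rV[R]_n -> Prop) :
  P 0 -> (forall a u v, P u -> P v -> P (a *: u + v)) ->
  exists m (E : 'M[R]_(m, n)), (forall v, P v <-> exists u, v = u *m E) /\
    (forall u : 'rV_m, u *m E = 0 -> map_mx rho u = 0).
Proof.
move=> P0 Plin; have [m [E EP]] := noetherian_row noethR P0 Plin.
have [|m' [x [gen minx]]] := @minimal_generators _ P _ (fun i => row i E).
  by move=> v; rewrite EP; split=> -[u ->]; exists u; rewrite lincomb_row.
exists m', (\matrix_i x i).
have xE u : u *m (\matrix_i x i) = lincomb x u.
  by rewrite -lincomb_row; apply: eq_bigr => i _; rewrite rowK.
split=> [v|u]; last by rewrite xE; apply: minx.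
by rewrite gen; split=> -[u ->]; exists u; rewrite xE.
Qed.

Lemma minimal_kernel g h (E : 'M[R]_(g, h)) :
  exists c : {m & 'M[R]_(m, g)},
    (forall v : 'rV_g, v *m E = 0 <-> exists u, v = u *m projT2 c) /\
    (forall u : 'rV_(projT1 c), u *m projT2 c = 0 -> map_mx rho u = 0).
Proof.
have [||m [E' E'P]] := @minimal_rows g (fun v : 'rV_g => v *m E = 0).
- by rewrite mul0mx.
- by move=> a u v u0 v0; rewrite mulmxDl -scalemxAl u0 v0 scaler0 addr0.
by exists (existT _ m E').
Qed.

(** A matrix with its two sizes. *)
Record stage := Stage {src : nat; tgt : nat; mat :> 'M[R]_(src, tgt)}.

(** A matrix whose rows minimally generate the kernel of [E], acting on row
    vectors. *)
Definition next_stage (E : stage) : stage :=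
  Stage (projT2 (projT1 (cid (minimal_kernel E)))).

Section Tower.
Variables (g h : nat) (E0 : 'M[R]_(g, h)).

(** The complex of free modules that starts with [E0] and continues with minimal
    generators of the successive kernels; [tower_mx n] maps row vectors of size
    [tower_rank n.+1] to row vectors of size [tower_rank n], and [tower_mx 0] is
    convertible to [E0]. *)
Definition tower n : stage := iter n next_stage (Stage E0).
Definition tower_rank n : nat := tgt (tower n).
Definition tower_mx n : 'M[R]_(tower_rank n.+1, tower_rank n) := tower n.

Lemma tower_exact n (v : 'rV_(tower_rank n.+1)) :
  v *m tower_mx n = 0 <-> exists u, v = u *m tower_mx n.+1.
Proof. exact: (svalP (cid (minimal_kernel (tower n)))).1. Qed.

Lemma tower_min n (u : 'rV_(tower_rank n.+2)) :
  u *m tower_mx n.+1 = 0 -> map_mx rho u = 0.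
Proof. exact: (svalP (cid (minimal_kernel (tower n)))).2. Qed.

End Tower.

End MinimalGenerators.

Section FreeResolution.
Variables (R : comNzRingType) (M : lmodType R) (p : nat -> nat).
Variables (D : forall n, 'M[R]_(p n.+1, p n)).
Variables (eps : {linear 'rV[R]_(p 0) -> M}).
Hypotheses (eps_surj : forall y, exists x, eps x = y)
  (eps_ker : forall v, eps v = 0 <-> exists u, v = u *m D 0)
  (D_exact : forall n (v : 'rV_(p n.+1)),
       v *m D n = 0 <-> exists u, v = u *m D n.+1).

(** The resolution of [M] by free modules of row vectors given by matrices. *)
Definition free_resolution : proj_resolution M.
Proof.
refine (@ProjResolution R M (fun n => 'rV[R]_(p n)) (fun n => mulmxr (D n)) eps
  (fun n => @row_projective R (p n)) eps_surj _ _).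
- by move=> x; rewrite eps_ker; split=> -[y yx]; exists y.
- move=> n x; split=> [/D_exact[y yx]|[y yx]]; first by exists y.
  by apply/D_exact; exists y.
Defined.

End FreeResolution.

(** * Tor in terms of matrices *)

Lemma factor_rows (R : comNzRingType) m n p
    (X : 'M[R]_(m, n)) (D : 'M[R]_(p, n)) :
  (forall i, exists u, row i X = u *m D) -> exists U, X = U *m D.
Proof.
move=> h; exists (\matrix_i sval (cid (h i))); apply/row_matrixP => i.
by rewrite row_mul rowK; case: cid.
Qed.

Lemma map_mx0P (R S : nzRingType) (f : {rmorphism R -> S}) m n
    (X : 'M[R]_(m, n)) :
  map_mx f X = 0 <-> forall i j, f (X i j) = 0.
Proof.
split=> [X0 i j|X0]; last by apply/matrixP => i j; rewrite !mxE.
by move/matrixP/(_ i j): X0; rewrite !mxE.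
Qed.

Section MatrixComplex.
Variables (R : comNzRingType).
Variables (p : nat -> nat) (D : forall n, 'M[R]_(p n.+1, p n)).
Hypothesis D_exact :
  forall n (v : 'rV_(p n.+1)), v *m D n = 0 <-> exists u, v = u *m D n.+1.

Lemma complex_mulmx n : D n.+1 *m D n = 0.
Proof.
apply/row_matrixP => i; rewrite row_mul row0; apply/D_exact.
by exists (delta_mx 0 i); rewrite -rowE.
Qed.

Lemma complex_factor n m (X : 'M_(m, p n.+1)) :
  X *m D n = 0 -> exists U, X = U *m D n.+1.
Proof.
move=> X0; apply: factor_rows => i; apply/D_exact.
by rewrite -row_mul X0 row0.
Qed.

End MatrixComplex.

Section TorShift.
Variables (R : comNzRingType).
Variables (p : nat -> nat) (D : forall n, 'M[R]_(p n.+1, p n)).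
Variables (q : nat -> nat) (E : forall n, 'M[R]_(q n.+1, q n)).
Hypothesis D_exact :
  forall n (v : 'rV_(p n.+1)), v *m D n = 0 <-> exists u, v = u *m D n.+1.
Hypothesis E_exact :
  forall n (v : 'rV_(q n.+1)), v *m E n = 0 <-> exists u, v = u *m E n.+1.

(** Elements of the tensor product of [R^(p n)] and [R^(q j)] are matrices of
    size [q j] by [p n].  If [D] resolves [N], this says that [Tor_(n+1)(N, -)]
    vanishes on the cokernel of [E j]: a chain with coefficients in that
    cokernel whose boundary is zero (modulo the image of [E j]) is a boundary
    (modulo the image of [E j]). *)
Definition mx_Tor_eq0 n j :=
  forall (X : 'M_(q j, p n.+1)) (Y : 'M_(q j.+1, p n)),
    X *m D n = (E j)^T *m Y ->
    exists (V : 'M_(q j, p n.+2)) (U : 'M_(q j.+1, p n.+1)),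
      X = V *m D n.+1 + (E j)^T *m U.

(** Dimension shifting: the cokernel of [E j.+1] is the syzygy of that of
    [E j]. *)
Lemma mx_Tor_shift n j : mx_Tor_eq0 n.+1 j -> mx_Tor_eq0 n j.+1.
Proof.
move=> T X Y XY.
have EE : (E j)^T *m (E j.+1)^T = 0.
  by rewrite -trmx_mul (complex_mulmx E_exact) trmx0.
have [X' X'E] : exists X', (E j)^T *m X = X' *m D n.+1.
  by apply: complex_factor => //; rewrite -mulmxA XY mulmxA EE mul0mx.
have [V [U VU]] := T X' X (esym X'E).
have : (X - U *m D n.+1)^T *m E j = 0.
  apply: (can_inj trmxK); rewrite trmx_mul trmxK trmx0 mulmxBr X'E VU.
  by rewrite mulmxDl -mulmxA (complex_mulmx D_exact) mulmx0 add0r mulmxA subrr.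
move/(complex_factor E_exact) => [W WE].
exists U, W^T; apply/eqP; rewrite addrC -subr_eq; apply/eqP.
by apply: (can_inj trmxK); rewrite trmx_mul !trmxK.
Qed.

End TorShift.

(** * Vanishing of Tor over a fiber product *)

Section FiberProduct.
Variables (R : comNzRingType) (k : fieldType) (rho : {rmorphism R -> k}).
Hypothesis rho_unit : forall x, rho x != 0 -> exists y, y * x = 1.

(** The maximal ideal, which is the kernel of [rho], is the direct sum of the
    nonzero ideals [I], kernel of [t], and [J], kernel of [s].  In the second
    clause [a] is the component in [I] of [x].  A matrix has its entries in [I]
    (resp. [J]) when its image under [t] (resp. [s]) is zero.  That [I] and [J]
    lie in the maximal ideal is not required separately: being nonzero with
    zero intersection, they are proper ideals. *)
Definition fiber_maps (S T : comNzRingType) (s : {rmorphism R -> S})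
    (t : {rmorphism R -> T}) : Prop :=
  [/\ forall x, s x = 0 -> t x = 0 -> x = 0,
      forall x, rho x = 0 -> exists a, t a = 0 /\ s a = s x,
      exists2 a, a != 0 & t a = 0 & exists2 b, b != 0 & s b = 0].

Lemma fiber_maps_sym (S T : comNzRingType) (s : {rmorphism R -> S})
    (t : {rmorphism R -> T}) :
  fiber_maps s t -> fiber_maps t s.
Proof.
move=> [inj spl nI nJ]; split=> // [x tx sx|x /spl[a [ta sa]]].
  exact: inj.
by exists (x - a); rewrite !rmorphB ta sa subr0 subrr.
Qed.

Section Types.
Variables (S T : comNzRingType).
Variables (s : {rmorphism R -> S}) (t : {rmorphism R -> T}).
Hypothesis st : fiber_maps s t.

Lemma map_mx_inj2 m n (X : 'M_(m, n)) :
  map_mx s X = 0 -> map_mx t X = 0 -> X = 0.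
Proof.
have [inj _ _ _] := st; move=> /map_mx0P sX /map_mx0P tX.
by apply/matrixP => i j; rewrite mxE; apply: inj.
Qed.

Lemma map_mx_split m n (X : 'M_(m, n)) : map_mx rho X = 0 ->
  exists C, map_mx t C = 0 /\ map_mx s C = map_mx s X.
Proof.
have [_ spl _ _] := st; move=> /map_mx0P rX.
exists (\matrix_(i, j) sval (cid (spl _ (rX i j)))).
by split; apply/matrixP => i j; rewrite !mxE; case: cid => a [].
Qed.

Lemma nakayama_mx m n (A : 'M_m) (X : 'M_(m, n)) :
  map_mx rho A = 0 -> X = A *m X -> X = 0.
Proof.
move=> rA XE.
have [|y yd] := rho_unit (x := \det (1%:M - A)).
  by rewrite -det_map_mx map_mxB map_mx1 rA subr0 det1 oner_eq0.
have : (1%:M - A) *m X = 0 by rewrite mulmxBl mul1mx -XE subrr.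
move/(congr1 (mulmx (y *: \adj (1%:M - A)))).
by rewrite mulmxA -scalemxAl mul_adj_mx scale_scalar_mx yd mul1mx mulmx0.
Qed.

(** When the rows of [D1] are minimal generators of the kernel of [D0], the last
    hypothesis says that no minimal generator of this kernel has all its
    coordinates in the kernel [J] of [s]; the conclusion is that the entries of
    [D1] are in the kernel [I] of [t]. *)
Lemma type_dichotomy p0 p1 p2 (D0 : 'M_(p1, p0)) (D1 : 'M_(p2, p1)) :
  (forall v : 'rV_p1, v *m D0 = 0 <-> exists u, v = u *m D1) ->
  map_mx rho D1 = 0 ->
  (forall b : 'rV_p2, map_mx s (b *m D1) = 0 -> map_mx rho b = 0) ->
  map_mx t D1 = 0.
Proof.
move=> exD rD1 nJ.
have DD : D1 *m D0 = 0.
  apply/row_matrixP => i; rewrite row_mul row0; apply/exD.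
  by exists (delta_mx 0 i); rewrite -rowE.
have [C [tC sC]] := map_mx_split rD1.
(* B is the component of D1 in J.  Its rows are again syzygies, so B = A D1; by
   assumption A is zero modulo the maximal ideal, and comparing components in J
   gives B = A B. *)
pose B := D1 - C.
have sB : map_mx s B = 0 by rewrite map_mxB sC subrr.
have tB : map_mx t B = map_mx t D1 by rewrite map_mxB tC subr0.
have BD0 : B *m D0 = 0.
  by apply: map_mx_inj2; rewrite map_mxM ?sB ?mul0mx // tB -map_mxM DD map_mx0.
have [A BE] : exists A, B = A *m D1.
  by apply: factor_rows => i; apply/exD; rewrite -row_mul BD0 row0.
have rA : map_mx rho A = 0.
  apply/row_matrixP => i; rewrite row0 -map_row; apply: nJ.
  by rewrite -row_mul -BE map_row sB row0.
have : B = A *m B.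
  apply/eqP; rewrite -subr_eq0; apply/eqP/map_mx_inj2; rewrite map_mxB map_mxM.
    by rewrite sB mulmx0 subr0.
  by rewrite {2}tB -map_mxM -BE subrr.
by move/(nakayama_mx rA) => B0; rewrite -tB B0 map_mx0.
Qed.

End Types.

Section Vanishing.
Variables (p : nat -> nat) (D : forall n, 'M[R]_(p n.+1, p n)).
Variables (q : nat -> nat) (E : forall n, 'M[R]_(q n.+1, q n)).
Hypothesis D_exact :
  forall n (v : 'rV_(p n.+1)), v *m D n = 0 <-> exists u, v = u *m D n.+1.
Hypothesis E_exact :
  forall n (v : 'rV_(q n.+1)), v *m E n = 0 <-> exists u, v = u *m E n.+1.
Hypothesis D_min : forall n (u : 'rV_(p n.+1)),
  u *m D n = 0 -> map_mx rho u = 0.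
Hypothesis E_min : forall n (u : 'rV_(q n.+1)),
  u *m E n = 0 -> map_mx rho u = 0.

Lemma minimal_map0 r (F : forall n, 'M[R]_(r n.+1, r n)) :
  (forall n (v : 'rV_(r n.+1)), v *m F n = 0 <-> exists u, v = u *m F n.+1) ->
  (forall n (u : 'rV_(r n.+1)), u *m F n = 0 -> map_mx rho u = 0) ->
  forall n, map_mx rho (F n.+1) = 0.
Proof.
move=> exF minF n; apply/row_matrixP => i; rewrite -map_row row0.
by apply: (minF n); apply/exF; exists (delta_mx 0 i); rewrite -rowE.
Qed.

(** A minimal generator [a D (i+1)] of one syzygy module with coordinates in [I]
    and a minimal generator [b E (j+1)] of another one with coordinates in [J]
    cannot coexist when Tor vanishes: their tensor product is a cycle, hence a
    boundary, and boundaries are zero modulo the maximal ideal. *)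
Lemma mixed_types (S T : comNzRingType) (s : {rmorphism R -> S})
    (t : {rmorphism R -> T}) :
  fiber_maps s t -> forall i j (a : 'rV_(p i.+2)) (b : 'rV_(q j.+2)),
  mx_Tor_eq0 D E i.+1 j.+2 ->
  map_mx t (a *m D i.+1) = 0 -> map_mx s (b *m E j.+1) = 0 ->
  map_mx rho a = 0 \/ map_mx rho b = 0.
Proof.
move=> st i j a b Tor ta sb.
have [Y XY] : exists Y, (b^T *m a) *m D i.+1 = (E j.+2)^T *m Y.
  have : ((b^T *m a) *m D i.+1)^T *m E j.+1 = 0.
    rewrite -mulmxA trmx_mul trmxK -mulmxA; apply: (map_mx_inj2 st).
      by rewrite map_mxM sb mulmx0.
    by rewrite map_mxM -map_trmx ta trmx0 mul0mx.
  move/(complex_factor E_exact) => [U UE]; exists U^T.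
  by apply: (can_inj trmxK); rewrite UE trmx_mul !trmxK.
have [V [U /(congr1 (map_mx rho))]] := Tor _ _ XY.
rewrite map_mxD !map_mxM -!map_trmx.
rewrite (minimal_map0 D_exact D_min) (minimal_map0 E_exact E_min).
rewrite trmx0 mulmx0 mul0mx addr0 => /matrixP ab.
have [|a0] := pselect (map_mx rho a = 0); [by left|right].
have [j0 aj0] : exists j, rho (a 0 j) != 0.
  apply: contrapT => na; apply: a0; apply/map_mx0P => i' j'; rewrite ord1.
  by apply/eqP/negPn/negP => h; apply: na; exists j'.
apply/map_mx0P => i' j'; rewrite ord1.
have := ab j' j0; rewrite !mxE big_ord1 !mxE => /eqP.
by rewrite mulf_eq0 (negPf aj0) orbF => /eqP.
Qed.

(** The hypothesis on [D 1] provides a minimal generator of the kernel of [D 0]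
    with coordinates in [I]. *)
Lemma pure_type_vanishing (S T : comNzRingType) (s : {rmorphism R -> S})
    (t : {rmorphism R -> T}) :
  fiber_maps s t ->
  mx_Tor_eq0 D E 1 2 -> mx_Tor_eq0 D E 1 3 ->
  ~ (forall a : 'rV_(p 2), map_mx t (a *m D 1) = 0 -> map_mx rho a = 0) ->
  E 1 = 0.
Proof.
move=> st Tor2 Tor3 typeD.
have [a [ta ra]] : exists a : 'rV_(p 2),
    map_mx t (a *m D 1) = 0 /\ map_mx rho a <> 0.
  apply: contrapT => h; apply: typeD => a ta; apply: contrapT => ra.
  by apply: h; exists a.
have rE := minimal_map0 E_exact E_min.
have tE1 : map_mx t (E 1) = 0.
  apply: (type_dichotomy st (E_exact (n := 0))) => // b sb.
  by have [] := mixed_types st Tor2 ta sb.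
have tE2 : map_mx t (E 2) = 0.
  apply: (type_dichotomy st (E_exact (n := 1))) => // b sb.
  by have [] := mixed_types st Tor3 ta sb.
have [inj _ _ [c c0 sc]] := st.
(* If c is a nonzero element of J, then c e_i is killed by E 1, which has its
   entries in I, but it is not in the row space of E 2, which has its entries
   in I too. *)
have qn (i : 'I_(q 2)) : False.
  have /E_exact[u uE] : (c *: delta_mx 0 i : 'rV_(q 2)) *m E 1 = 0.
    apply: (map_mx_inj2 st); last by rewrite map_mxM tE1 mulmx0.
    by rewrite -scalemxAl map_mxZ sc scale0r.
  have : map_mx t (c *: delta_mx 0 i : 'rV_(q 2)) = 0.
    by rewrite uE map_mxM tE2 mulmx0.
  move/map_mx0P/(_ 0 i); rewrite !mxE !eqxx mulr1 => tc.
  by move/eqP: c0; apply; apply: inj.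
by apply/matrixP => i; case: (qn i).
Qed.

(** If [Tor_4] and [Tor_5] of the modules resolved by [D] and [E] vanish, then
    one of their second syzygies is zero. *)
Theorem fiber_product_vanishing (S T : comNzRingType)
    (s : {rmorphism R -> S}) (t : {rmorphism R -> T}) :
  fiber_maps s t -> mx_Tor_eq0 D E 3 0 -> mx_Tor_eq0 D E 4 0 ->
  D 1 = 0 \/ E 1 = 0.
Proof.
move=> st Tor4 Tor5.
have Tor2 : mx_Tor_eq0 D E 1 2 by do 2!apply: mx_Tor_shift => //.
have Tor3 : mx_Tor_eq0 D E 1 3 by do 3!apply: mx_Tor_shift => //.
have [typeI|] := pselect (forall a : 'rV_(p 2),
    map_mx t (a *m D 1) = 0 -> map_mx rho a = 0);
  last by right; apply: pure_type_vanishing st _ _ _.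
have [typeJ|] := pselect (forall a : 'rV_(p 2),
    map_mx s (a *m D 1) = 0 -> map_mx rho a = 0);
  last by right; apply: pure_type_vanishing (fiber_maps_sym st) _ _ _.
have rD := minimal_map0 D_exact D_min 0.
left; apply: (map_mx_inj2 st).
  exact: (type_dichotomy (fiber_maps_sym st) (D_exact (n := 0))).
exact: (type_dichotomy st (D_exact (n := 0))).
Qed.

End Vanishing.
End FiberProduct.

(** * Fiber product rings *)

Section LocalRing.
Import classical_sets.
Local Open Scope classical_set_scope.
Variable R : comNzRingType.

Lemma exists_maximal_ideal (I : {pred R}) : idealr_closed I ->
  exists2 m : {pred R}, maximal_ideal m & {subset I <= m}.
Proof.
move=> idI; pose good (A : set R) := idealr_closed (fun x => `[< A x >]) /\
  {subset I <= (fun x => `[< A x >])}.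
(* The empty set is included because it is the union of the empty chain. *)
have [|A [[A0|[idA IA]] maxA]] := @Zorn_bigcup R (fun A => A = set0 \/ good A).
- move=> F FP totF.
  have [[A [FA gA]]|nF] := pselect (exists A, F A /\ good A); last first.
    left; rewrite -subset0 => x [A FA Ax].
    have [A0|gA] := FP A FA; first by rewrite A0 in Ax.
    by apply: nF; exists A.
  have [[A0 A1 Alin] IA] := gA.
  right; split; first split.
  - by apply/asboolP; exists A => //; apply/asboolP.
  - apply/negP => /asboolP[B FB B1].
    have [B0|[[_ nB1 _] _]] := FP B FB; first by rewrite B0 in B1.
    by move/negP: nB1; apply; apply/asboolP.
  - move=> a u v /asboolP[B FB Bu] /asboolP[C FC Cv]; apply/asboolP.
    have [U [FU Uu Uv]] : exists U, [/\ F U, U u & U v].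
      have [BC|CB] := totF B C FB FC; first by exists C; split=> //; apply: BC.
      by exists B; split=> //; apply: CB.
    exists U => //; have [U0|[[_ _ Ulin] _]] := FP U FU.
      by rewrite U0 in Uu.
    by apply/asboolP/Ulin; apply/asboolP.
  - by move=> x /IA/asboolP Ax; apply/asboolP; exists A.
- case: (maxA [set` I]); last first.
    right; rewrite /good.
    have -> : (fun x => `[< [set` I] x >]) = I.
      by apply/funext => x; apply: asboolb.
    by split.
  rewrite A0; split; first exact: sub0set.
  by move/(_ 0) => h; apply: h; case: idI.
exists (fun x => `[< A x >]); last by [].
split=> // J idJ AJ x; apply/idP/idP; last exact: AJ.
move=> Jx; apply: contrapT => nAx; apply: (maxA [set` J]).
  split; first by move=> y Ay; apply: AJ; apply/asboolP.
  by move/(_ x Jx) => Ax; apply: nAx; apply/asboolP.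
right; rewrite /good.
have -> : (fun x => `[< [set` J] x >]) = J by apply/funext => y; apply: asboolb.
by split=> // y /IA/AJ.
Qed.

Lemma residue_unit (k : fieldType) (rho : {rmorphism R -> k}) :
  local_ring R -> (forall a, exists x, rho x = a) ->
  forall x, rho x != 0 -> exists y, y * x = 1.
Proof.
move=> [m _ mP] rho_surj x rx.
pose K : {pred R} := fun x => rho x == 0.
have idK : idealr_closed K.
  split; rewrite ?unfold_in ?rmorph0 ?rmorph1 ?oner_eq0 //.
  move=> a u v; rewrite !unfold_in => /eqP u0 /eqP v0.
  by rewrite rmorphD rmorphM u0 v0 mulr0 addr0.
have maxK : maximal_ideal K.
  split=> // I [_ /negP I1 Ilin] KI y; apply/idP/idP => [Iy|]; last exact: KI.
  apply/negPn/negP => ry; have [z rz] := rho_surj (rho y)^-1.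
  apply: I1; rewrite -[1](subrK (z * y)) addrC; apply: Ilin => //.
  by apply: KI; rewrite unfold_in rmorphB rmorphM rmorph1 rz mulVf // subrr.
apply: contrapT => nx; pose I : {pred R} := fun y => `[< exists z, y = z * x >].
have idI : idealr_closed I.
  split; first by apply/asboolP; exists 0; rewrite mul0r.
    by apply/negP => /asboolP[z zx]; apply: nx; exists z.
  move=> a u v /asboolP[y ->] /asboolP[z ->]; apply/asboolP.
  by exists (a * y + z); rewrite mulrDl mulrA.
have [m' maxm' Im'] := exists_maximal_ideal idI.
have : x \in m' by apply: Im'; apply/asboolP; exists 1; rewrite mul1r.
by rewrite (mP _ maxm') -(mP _ maxK) unfold_in (negPf rx).
Qed.

End LocalRing.

Lemma fiber_product_maps (R : comNzRingType) : fiber_product_ring R ->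
  exists (k : fieldType) (rho : {rmorphism R -> k}) (S T : comNzRingType)
    (s : {rmorphism R -> S}) (t : {rmorphism R -> T}),
    (forall a, exists x, rho x = a) /\ fiber_maps rho s t.
Proof.
move=> [_ [S [T [k [pS [pT [_ [pS_surj pT_surj] [npS npT] [f [f_inj fP]]]]]]]]].
pose s : {rmorphism R -> S} := fst \o f.
pose t : {rmorphism R -> T} := snd \o f.
pose rho : {rmorphism R -> k} := pS \o s.
have rhoE x : rho x = pT (t x) by apply/fP; exists x.
have lift a b : pS a = pT b -> exists x, s x = a /\ t x = b.
  by move=> ab; have [x xE] := (fP (a, b)).2 ab; exists x; rewrite /s /t /= xE.
have kernel_nz (A : comNzRingType) (g : {rmorphism A -> k}) :
    ~ injective g -> exists2 a, a != 0 & g a = 0.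
  move=> ninj; apply: contrapT => h; apply: ninj => x y xy; apply/eqP.
  rewrite -subr_eq0; apply/negPn/negP => nxy; apply: h; exists (x - y) => //.
  by rewrite rmorphB xy subrr.
exists k, rho, S, T, s, t; split.
  move=> a; have [x xa] := pS_surj a; have [y ya] := pT_surj a.
  have [|z [zx _]] := lift x y; first by rewrite xa ya.
  by exists z; rewrite /rho /= -[f z]/(f z) -xa -zx.
split=> [x sx tx|x rx||].
- apply: f_inj; rewrite rmorph0 [f x]surjective_pairing.
  by rewrite -[(f x).1]/(s x) -[(f x).2]/(t x) sx tx.
- have [|a [sa ta]] := lift (s x) 0; first by rewrite rmorph0.
  by exists a.
- have [a a0 ga] := kernel_nz _ _ npS; have [|x [sx tx]] := lift a 0.
    by rewrite ga rmorph0.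
  by exists x => //; apply: contra_neq a0 => x0; rewrite -sx x0 rmorph0.
have [b b0 gb] := kernel_nz _ _ npT; have [|x [sx tx]] := lift 0 b.
  by rewrite gb rmorph0.
by exists x => //; apply: contra_neq b0 => x0; rewrite -tx x0 rmorph0.
Qed.

(** * From Ext to Tor *)

Section TorVectors.
Variables (R : comNzRingType) (g h : nat) (E : 'M[R]_(g, h)).
Variables (Z : lmodType R) (pi : {linear 'rV[R]_h -> Z}).
Hypotheses (pi_surj : forall z, exists v, pi v = z)
  (pi_ker : forall v, pi v = 0 <-> exists u, v = u *m E).

Lemma tens_of_vec_map (V W : lmodType R) (f : {linear V -> W}) (x : 'I_h -> V) :
  tens_map Z f (tens_of_vec pi x) = tens_of_vec pi (f \o x).
Proof.
by rewrite linear_sum; apply: eq_bigr => j _; rewrite tens_map_pure.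
Qed.

Lemma tens_of_vec_sub (V : lmodType R) (x y : 'I_h -> V) :
  tens_of_vec pi x - tens_of_vec pi y = tens_of_vec pi (fun j => x j - y j).
Proof.
by rewrite -sumrB; apply: eq_bigr => j _; rewrite linearBl.
Qed.

Lemma tens_of_vec_eq (V : lmodType R) (x y : 'I_h -> V) :
  tens_of_vec pi x = tens_of_vec pi y <->
  exists u, forall j, x j - y j = vec_act E u j.
Proof.
have e0 := tens_of_vec_eq0 pi_surj pi_ker.
split=> [xy|h']; first by apply/e0; rewrite -tens_of_vec_sub xy subrr.
by apply/eqP; rewrite -subr_eq0 tens_of_vec_sub; apply/eqP/e0.
Qed.

Lemma vec_act_row n (Y : 'M[R]_(g, n)) j :
  vec_act E (fun i => row i Y) j = row j (E^T *m Y).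
Proof.
rewrite row_mul mulmx_sum_row; apply: eq_bigr => i _; by rewrite !mxE.
Qed.

Lemma linear_vec_act (V W : lmodType R) (f : {linear V -> W}) y j :
  f (vec_act E y j) = vec_act E (f \o y) j.
Proof. by rewrite linear_sum; apply: eq_bigr => i _; rewrite linearZ. Qed.

End TorVectors.

Lemma Tor_eq0_mx (R : comNzRingType) (N Z : lmodType R) p
    (D : forall n, 'M[R]_(p n.+1, p n)) (eps : {linear 'rV[R]_(p 0) -> N})
    (eps_surj : forall y, exists x, eps x = y)
    (eps_ker : forall v, eps v = 0 <-> exists u, v = u *m D 0)
    (D_exact : forall n (v : 'rV_(p n.+1)),
       v *m D n = 0 <-> exists u, v = u *m D n.+1)
    q (E : forall n, 'M[R]_(q n.+1, q n)) (pi : {linear 'rV[R]_(q 0) -> Z})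
    (pi_surj : forall z, exists v, pi v = z)
    (pi_ker : forall v, pi v = 0 <-> exists u, v = u *m E 0) n :
  Tor_eq0 n.+1 N Z -> mx_Tor_eq0 D E n 0.
Proof.
move=> Tor X Y XY; pose P := free_resolution eps_surj eps_ker D_exact.
pose x j : P n.+1 := row j X.
have [|y] := Tor P (tens_of_vec pi x).
  rewrite /tor_cycle tens_of_vec_map; apply/(tens_of_vec_eq0 pi_surj pi_ker).
  exists (fun i => row i Y) => j /=.
  by rewrite vec_act_row -XY row_mul.
have [z ->] := tens_of_vec_surj pi_surj y.
rewrite tens_of_vec_map => /esym/(tens_of_vec_eq pi_surj pi_ker)[u uE].
exists (\matrix_j (z j : 'rV_(p n.+2))), (\matrix_i (u i : 'rV_(p n.+1))).
apply/row_matrixP => j; rewrite linearD /= row_mul rowK -vec_act_row.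
apply/eqP; rewrite addrC -subr_eq; apply/eqP; rewrite [LHS](uE j).
by apply: eq_bigr => i _; rewrite rowK.
Qed.

Section ExtTor.
Variables (R : comNzRingType) (M N : lmodType R) (q : nat -> nat).
Variables (D : forall n, 'M[R]_(q n.+1, q n)).
Variables (eps : {linear 'rV[R]_(q 0) -> M}).
Hypotheses (eps_surj : forall y, exists x, eps x = y)
  (eps_ker : forall v, eps v = 0 <-> exists u, v = u *m D 0)
  (D_exact : forall n (v : 'rV_(q n.+1)),
       v *m D n = 0 <-> exists u, v = u *m D n.+1).
Hypothesis hExt : Ext_eq0 1 M N.

(** A family [y] in [N] satisfying the relations [D 1] between the generators of
    the first syzygy of [M] extends to the free module that contains this
    syzygy. *)
Lemma Ext1_lift (y : 'I_(q 1) -> N) :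
  (forall j, \sum_i D 1 j i *: y i = 0) ->
  exists w : 'I_(q 0) -> N, forall i, y i = \sum_l D 0 i l *: w l.
Proof.
move=> y0; pose P := free_resolution eps_surj eps_ker D_exact.
have [|w wE] := hExt (P := P) (f := lincomb y : {linear P 1 -> N}).
  move=> u /=; rewrite mulmx_sum_row linear_sum big1 // => j _.
  rewrite linearZ /= [lincomb _ _](_ : _ = 0) ?scaler0 // -[RHS](y0 j).
  by apply: eq_bigr => i _; rewrite mxE.
exists (fun l => w (delta_mx 0 l)) => i.
rewrite -(lincomb_delta y i) [LHS]wE /= -rowE [LHS]linear_lincomb.
by apply: eq_bigr => l _; rewrite mxE.
Qed.

Variables (Z : lmodType R) (pi : {linear 'rV[R]_(q 2) -> Z}).
Hypotheses (pi_surj : forall z, exists v, pi v = z)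
  (pi_ker : forall v, pi v = 0 <-> exists u, v = u *m (D 1)^T).

(** [Z] is the transpose of the first syzygy of [M].  Nothing is used of the
    resolution of [N] but its exactness. *)
Lemma Tor1_transpose : Tor_eq0 1 N Z.
Proof.
move=> P t; have [x ->] := tens_of_vec_surj pi_surj t.
rewrite /= tens_of_vec_map => /(tens_of_vec_eq0 pi_surj pi_ker)[y xy].
have augd a : res_aug P (res_diff P 0 a) = 0 by apply/res_exact0; exists a.
(* The image of y in N is a cocycle by xy, hence a coboundary w. *)
have [|w wE] := @Ext1_lift (res_aug P \o y).
  move=> j; rewrite -[RHS](augd (x j)) [res_diff _ _ _]xy linear_vec_act.
  by apply: eq_bigr => i _; rewrite mxE.
have [w' w'E] := choice (fun l => res_aug_surj P (w l)).
have /choice[u uE] : forall i, exists a,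
    res_diff P 0 a = y i - \sum_l D 0 i l *: w' l.
  move=> i; apply/res_exact0.
  rewrite linearB [res_aug P (y i)]wE linear_sum; apply/eqP; rewrite subr_eq0.
  by apply/eqP/eq_bigr => l _; rewrite linearZ /= w'E.
have dE j : res_diff P 0 (vec_act (D 1)^T u j) = res_diff P 0 (x j).
  rewrite linear_vec_act [RHS]xy /vec_act.
  under eq_bigr do rewrite /= uE scalerBr.
  rewrite sumrB [X in _ - X](_ : _ = 0) ?subr0 //.
  under eq_bigr do rewrite scaler_sumr.
  rewrite exchange_big big1 // => l _.
  under eq_bigr do rewrite scalerA.
  rewrite -scaler_suml [\sum_i _](_ : _ = (D 1 *m D 0) j l); last first.
    by rewrite mxE; apply: eq_bigr => i _; rewrite mxE.
  by rewrite (complex_mulmx D_exact) mxE scale0r.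
have /choice[v vE] : forall j, exists a,
    res_diff P 1 a = x j - vec_act (D 1)^T u j.
  by move=> j; apply/res_exact; rewrite linearB dE subrr.
exists (tens_of_vec pi v); rewrite tens_of_vec_map.
apply/esym/(tens_of_vec_eq pi_surj pi_ker); exists u => j /=.
by rewrite vE opprB addrC subrK.
Qed.

End ExtTor.

(** * Tor-rigid modules over fiber products *)

Section Main.
Variables (R : comNzRingType) (k : fieldType) (rho : {rmorphism R -> k}).
Hypothesis rho_unit : forall x, rho x != 0 -> exists y, y * x = 1.
Hypothesis noethR : noetherian R.

(** The matrices [D] and the augmentation [eps] form a minimal free resolution
    of [M]; minimality is expressed by the last two clauses, all kernels having
    their coordinates in the maximal ideal. *)
Lemma minimal_resolution_exists (M : lmodType R) : fin_gen M ->
  exists (p : nat -> nat) (D : forall n, 'M[R]_(p n.+1, p n))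
    (eps : {linear 'rV[R]_(p 0) -> M}),
  [/\ forall y, exists x, eps x = y,
      forall v, eps v = 0 <-> exists u, v = u *m D 0,
      forall n (v : 'rV_(p n.+1)), v *m D n = 0 <-> exists u, v = u *m D n.+1,
      forall v, eps v = 0 -> map_mx rho v = 0 &
      forall n (u : 'rV_(p n.+1)), u *m D n = 0 -> map_mx rho u = 0].
Proof.
move=> [s sP].
have [|h [x [gen minx]]] := @minimal_generators _ _ _ rho_unit M (fun=> True) _
    (fun i : 'I_(size s) => s`_i).
  move=> v; split=> // _; have [c ->] := sP v; exists (\row_i c i).
  by apply: eq_bigr => i _; rewrite mxE.
have [||g [D0 [D0_ker D0_min]]] :=
    minimal_rows rho_unit noethR (P := fun v => lincomb x v = 0).
- exact: linear0.
- by move=> a u v u0 v0; rewrite linearP /= u0 v0 scaler0 addr0.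
exists (tower_rank rho_unit noethR D0), (tower_mx rho_unit noethR D0).
exists (lincomb x).
split=> //; first by move=> y; have [u ->] := (gen y).1 I; exists u.
  exact: tower_exact.
by case=> [|n] u; [apply: D0_min|apply: tower_min].
Qed.

(** If [u] is in the kernel of the transpose of [D 1] and [n] is in [N], then
    [i |-> u_i n] is a cocycle, hence a coboundary, so that each [u_i n] is in
    the maximal ideal times [N]; for a unit [u_i] this would contradict
    Nakayama's lemma. *)
Lemma transpose_minimal (M N : lmodType R) p (D : forall n, 'M[R]_(p n.+1, p n))
    (eps : {linear 'rV[R]_(p 0) -> M})
    (eps_surj : forall y, exists x, eps x = y)
    (eps_ker : forall v, eps v = 0 <-> exists u, v = u *m D 0)
    (D_exact : forall n (v : 'rV_(p n.+1)),
       v *m D n = 0 <-> exists u, v = u *m D n.+1)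
    (eps_min : forall v, eps v = 0 -> map_mx rho v = 0) :
  fin_gen N -> nonzero_module N -> Ext_eq0 1 M N ->
  forall u : 'rV_(p 1), u *m (D 1)^T = 0 -> map_mx rho u = 0.
Proof.
move=> N_fg [n0 n0P] Ext u uD.
have [q [_ [e [e_surj _ _ e_min _]]]] := minimal_resolution_exists N_fg.
apply/map_mx0P => i0 j; rewrite ord1 => {i0}; apply/eqP/negPn/negP => uj.
(* The minimal generator e_l of N would be in the maximal ideal times N, so N
   has no minimal generators at all. *)
have q0 (l : 'I_(q 0)) : False.
  have [|w wE] := Ext1_lift eps_surj eps_ker D_exact Ext
    (y := fun i => u 0 i *: e (delta_mx 0 l)).
    move=> j'; under eq_bigr do rewrite scalerA; rewrite -scaler_suml.
    move/matrixP/(_ 0 j'): uD; rewrite !mxE => uD.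
    rewrite (_ : \sum_i _ = 0) ?scale0r // -[RHS]uD.
    by apply: eq_bigr => i _; rewrite mxE mulrC.
  have [w' w'E] := choice (fun l => e_surj (w l)).
  have /e_min : e (u 0 j *: delta_mx 0 l - \sum_i D 0 j i *: w' i) = 0.
    rewrite linearB linearZ /= wE linear_sum; apply/eqP; rewrite subr_eq0.
    by apply/eqP/eq_bigr => i _; rewrite linearZ /= w'E.
  move/map_mx0P/(_ 0 l); rewrite !mxE rmorphB !eqxx mulr1.
  have -> : rho ((\sum_i D 0 j i *: w' i) 0 l) = 0.
    rewrite summxE rmorph_sum big1 // => i _; rewrite mxE rmorphM.
    have /eps_min/map_mx0P/(_ 0 i) : eps (row j (D 0)) = 0.
      by apply/eps_ker; exists (delta_mx 0 j); rewrite -rowE.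
    by rewrite mxE => ->; rewrite mul0r.
  by rewrite subr0 => /eqP; apply/negP.
have [v vE] := e_surj n0; move/eqP: n0P; apply; rewrite -vE.
rewrite [v](_ : _ = 0) ?linear0 //; apply/matrixP => i l; case: (q0 l).
Qed.

Lemma pd_le1 (N : lmodType R) g h (D : 'M[R]_(g, h))
    (eps : {linear 'rV[R]_h -> N}) :
  (forall y, exists x, eps x = y) ->
  (forall v, eps v = 0 <-> exists u, v = u *m D) ->
  (forall v : 'rV_g, v *m D = 0 -> v = 0) -> pd_le N 1.
Proof.
move=> eps_surj eps_ker D_inj.
pose p n := match n with 0 => h | 1 => g | _ => 0%N end.
pose D' n : 'M[R]_(p n.+1, p n) := match n with 0 => D | _ => 0 end.
have D'_exact n (v : 'rV_(p n.+1)) :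
    v *m D' n = 0 <-> exists u, v = u *m D' n.+1.
  case: n v => [|n] v.
    split=> [/D_inj ->|[u ->]]; last by rewrite mulmx0 mul0mx.
    by exists 0; rewrite mul0mx.
  by rewrite [v]thinmx0 mul0mx; split=> // _; exists 0; rewrite mul0mx.
exists (@free_resolution _ N p D' eps eps_surj eps_ker D'_exact).
by case=> [|[|n]] // _ x; apply: thinmx0.
Qed.

(** The conclusion holds over every Noetherian local ring whose maximal ideal is
    the direct sum of two nonzero ideals. *)
Theorem tor_rigid_ext (S T : comNzRingType) (s : {rmorphism R -> S})
    (t : {rmorphism R -> T}) (M N : lmodType R) :
  fiber_maps rho s t -> fin_gen M -> fin_gen N -> nonzero_module N ->
  Tor_rigid N -> Ext_eq0 1 M N -> free_module M \/ pd_le N 1.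
Proof.
move=> st M_fg N_fg N_nz rigid Ext.
have [m [A [e [e_surj e_ker A_exact e_min _]]]] :=
  minimal_resolution_exists M_fg.
have [p [D [e' [e'_surj e'_ker D_exact _ D_min]]]] :=
  minimal_resolution_exists N_fg.
pose E := tower_mx rho_unit noethR (A 1)^T.
have E_exact := tower_exact
  (rho_unit := rho_unit) (noethR := noethR) (E0 := (A 1)^T).
have E_min n (u : 'rV_(tower_rank rho_unit noethR (A 1)^T n.+1)) :
    u *m E n = 0 -> map_mx rho u = 0.
  case: n u => [|n] u; last exact: tower_min.
  exact: (transpose_minimal e_surj e_ker A_exact e_min N_fg N_nz Ext).
have [||Z [pi [pi_surj pi_ker]]] :=
    @quotient_module_exists R 'rV[R]_(m 2)
      (fun v => exists u, v = u *m (A 1)^T).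
- by exists 0; rewrite mul0mx.
- move=> a u v [u' ->] [v' ->]; exists (a *: u' + v').
  by rewrite mulmxDl scalemxAl.
have Z_fg : fin_gen Z.
  exists [seq pi (delta_mx 0 j) | j <- enum 'I_(m 2)] => z.
  have [v <-] := pi_surj z.
  rewrite /in_span size_map size_enum_ord; exists (fun j => v 0 j).
  rewrite [v in LHS]row_sum_delta linear_sum; apply: eq_bigr => j _.
  by rewrite linearZ (nth_map j) ?size_enum_ord // nth_ord_enum.
have Tor n : Tor_eq0 n.+1 N Z.
  elim: n => [|n]; last exact: rigid.
  exact: (Tor1_transpose e_surj e_ker A_exact Ext pi_surj pi_ker).
have mxTor n : mx_Tor_eq0 D E n 0.
  exact: (Tor_eq0_mx e'_surj e'_ker D_exact (E := E) pi_surj pi_ker (Tor n)).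
have [D1|E1] := fiber_product_vanishing rho_unit D_exact E_exact D_min E_min st
    (mxTor 3) (mxTor 4).
  right; apply: (pd_le1 e'_surj e'_ker) => v /D_exact[u ->].
  by rewrite D1 mulmx0.
left; have A0 : A 0 = 0.
  apply: (can_inj trmxK); rewrite trmx0.
  have /(complex_factor E_exact (n := 0))[U ->] : (A 0)^T *m E 0 = 0.
    by rewrite -trmx_mul (complex_mulmx A_exact) trmx0.
  exact: (etrans (congr1 (mulmx U) E1) (mulmx0 _ _)).
exists (m 0), e; have [r rK] := choice e_surj.
exists r => // v; apply/eqP; rewrite -subr_eq0; apply/eqP.
have /e_ker[u ->] : e (r (e v) - v) = 0 by rewrite linearB rK subrr.
by rewrite A0 mulmx0.
Qed.

End Main.

Theorem corollary3p16 (R : comNzRingType)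
    (hfiber : fiber_product_ring R) (hCM : cohen_macaulay R)
    (M N : lmodType R) (hMfg : fin_gen M) (hNfg : fin_gen N)
    (hM0 : nonzero_module M) (hN0 : nonzero_module N)
    (hrigid : Tor_rigid N) (hExt : Ext_eq0 1 M N) :
  free_module M \/ pd_le N 1.
Proof.
have [k [rho [S [T [s [t [rho_surj st]]]]]]] := fiber_product_maps hfiber.
have [[noethR locR] _] := hfiber.
exact: (tor_rigid_ext (residue_unit locR rho_surj) noethR st).
Qed.
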